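(* Let $G$ be a group, let $S$ be a generating $n$-tuple for $G$ with $n \leq 3$, and let $H$ be a subgroup of finite index in $G$ with $n \leq [G:H]$. Then there is a generating $n$-tuple $S'$ of $G$ which is Nielsen equivalent to $S$, and a left-right transversal $T$ for $H$ in $G$, such that $\tilde{S'} \subseteq T$, where $\tilde{S'}$ denotes the set of entries of $S'$.
   Context: A generating $n$-tuple of a group $G$ is an element $(g_1,\ldots,g_n)$ of $G^n$ such that $\{g_1,\ldots,g_n\}$ generates $G$. A standard Nielsen move on it replaces some entry $g_i$ with one of $g_jg_i$, $g_j^{-1}g_i$, $g_ig_j$, $g_ig_j^{-1}$, where $j \neq i$. An extended Nielsen move either replaces an entry $g_i$ by its inverse, or transposes two entries $g_i$ and $g_j$ with $i \neq j$. A Nielsen move is a standard or an extended Nielsen move. Two generating $n$-tuples of $G$ are Nielsen equivalent if they differ by a finite number of Nielsen moves. A left-right transversal for $H$ in $G$ is a set which is simultaneously a left transversal (contains exactly one element of each left coset $gH$) and a right transversal (contains exactly one element of each right coset $Hg$) for $H$ in $G$. *)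

(* Defs.v *)
From HB Require Import structures.
From mathcomp Require Import all_boot.
From mathcomp Require Import perm finmap.
From mathcomp Require Import all_classical.
From Stdlib Require Import Relation_Operators.
Set Implicit Arguments.
Unset Strict Implicit.
Unset Printing Implicit Defensive.

Local Open Scope classical_set_scope.
Local Open Scope group_scope.

Definition is_subgroup (G : groupType) (H : set G) : Prop := group_closed (mem H).

Definition generated (G : groupType) (A : set G) : set G :=
  smallest (@is_subgroup G) A.

Definition left_coset (G : groupType) (H : set G) (g : G) : set G :=
  [set g * h | h in H].

Definition right_coset (G : groupType) (H : set G) (g : G) : set G :=
  [set h * g | h in H].

Definition finite_index (G : groupType) (H : set G) : Prop :=
  finite_set (range (left_coset H)).

(* Meaningful only under [finite_index H]: [fset_set] sends infinite sets to
   the empty finite set. *)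
Definition subgroup_index (G : groupType) (H : set G) : nat :=
  #|` fset_set (range (left_coset H))|.

Definition left_transversal (G : groupType) (H T : set G) : Prop :=
  forall g : G, exists! t : G, T t /\ left_coset H g t.

Definition right_transversal (G : groupType) (H T : set G) : Prop :=
  forall g : G, exists! t : G, T t /\ right_coset H g t.

Definition left_right_transversal (G : groupType) (H T : set G) : Prop :=
  left_transversal H T /\ right_transversal H T.

Definition generating_tuple (G : groupType) (n : nat)
    (S : {ffun 'I_n -> G}) : Prop :=
  generated (range S) = [set: G].

Definition replace_entry (G : groupType) (n : nat)
    (S : {ffun 'I_n -> G}) (i : 'I_n) (x : G) : {ffun 'I_n -> G} :=
  [ffun k => if k == i then x else S k].

Inductive standard_nielsen_move (G : groupType) (n : nat)
    (S : {ffun 'I_n -> G}) : {ffun 'I_n -> G} -> Prop :=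
| Nielsen_mull (i j : 'I_n) : j != i ->
    standard_nielsen_move S (replace_entry S i (S j * S i))
| Nielsen_mulVl (i j : 'I_n) : j != i ->
    standard_nielsen_move S (replace_entry S i ((S j)^-1 * S i))
| Nielsen_mulr (i j : 'I_n) : j != i ->
    standard_nielsen_move S (replace_entry S i (S i * S j))
| Nielsen_mulrV (i j : 'I_n) : j != i ->
    standard_nielsen_move S (replace_entry S i (S i * (S j)^-1)).

Inductive extended_nielsen_move (G : groupType) (n : nat)
    (S : {ffun 'I_n -> G}) : {ffun 'I_n -> G} -> Prop :=
| Nielsen_inv (i : 'I_n) :
    extended_nielsen_move S (replace_entry S i (S i)^-1)
| Nielsen_swap (i j : 'I_n) : i != j ->
    extended_nielsen_move S [ffun k => S (tperm i j k)].

Definition nielsen_move (G : groupType) (n : nat)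
    (S S' : {ffun 'I_n -> G}) : Prop :=
  standard_nielsen_move S S' \/ extended_nielsen_move S S'.

(* No symmetric closure is needed: the inverse of a Nielsen move is again a
   Nielsen move. *)
Definition nielsen_equivalent (G : groupType) (n : nat)
    (S S' : {ffun 'I_n -> G}) : Prop :=
  clos_refl_trans _ (@nielsen_move G n) S S'.

(* Main.v *)
(* A set meeting every left and every right coset of [H] at most once extends to
   a left-right transversal, so it suffices to reach a tuple whose entries lie in
   pairwise distinct left cosets and in pairwise distinct right cosets.  If two
   entries outside [H] share a coset, then a standard move replaces one of them
   by their quotient, which lies in [H]; so one may assume that the entries
   outside [H] are separated.  An entry in [H] and one outside never share a
   coset.  There remains the triple [(a, b, c)] with [a], [b] in [H] and [c]
   outside: if [c y c] is not in [H] for some [y] among [a], [b], [a^-1 b], then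
   it can replace [a] or [b].  Otherwise
   [c^2 = (c a^-1 b c) ((c a c)^-1 (c b c))^-1] is in [H], and so are
   [c^-1 a c = c^-2 (c a c)] and [c^-1 b c]; hence the group is the union of [H]
   and [cH], against the index being at least 3. *)
Require Import Defs.
From HB Require Import structures.
From mathcomp Require Import all_boot.
From mathcomp Require Import fingroup perm finmap.

Local Open Scope group_scope.

(** * Partial transversals in a finite group *)

(** Multiplication is injective on pairs from [S] and [K], because distinct elements of [S] lie in
    distinct left cosets of [K]. *)
Lemma card_mulg_left_partial (gT : finGroupType) (K : {group gT}) (S : {set gT}) :
  {in S &, forall x y, x^-1 * y \in K -> x = y} ->
  #|(S * K)%g| = (#|S| * #|K|)%N.
Proof.
move=> injS; rewrite -cardsX /= -[RHS](card_in_imset (f := uncurry *%g)).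
  by rewrite -curry_imset2X.
move=> [x h] [y k] /[!inE] /= /andP[xS hK] /andP[yS kK] exy.
have E : x = y.
  apply: injS => //; rewrite -[y](mulgK k) -exy !mulgA mulVg mul1g.
  by rewrite groupM ?groupV.
by move: exy; rewrite E => /mulgI->.
Qed.

Lemma card_mulg_right_partial (gT : finGroupType) (K : {group gT}) (S : {set gT}) :
  {in S &, forall x y, x * y^-1 \in K -> x = y} ->
  #|(K * S)%g| = (#|S| * #|K|)%N.
Proof.
move=> injS; rewrite -card_invg invMg invGid.
rewrite card_mulg_left_partial ?card_invg// => x y.
rewrite !mem_invg => xS yS xyK; apply: invg_inj; apply: injS => //.
by rewrite invgK.
Qed.

(* Inside a double coset [KgK] both a left coset and a right coset consist of
   [#|K|] elements, and every left coset meets every right coset; hence a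
   partial transversal missing a left coset of [KgK] also misses a right coset
   of [KgK], and can be enlarged by an element of their intersection. *)
Lemma partial_transversal_extends_fin (gT : finGroupType) (G K : {group gT})
    (S : {set gT}) :
  K \subset G -> S \subset G ->
  {in S &, forall x y, x^-1 * y \in K -> x = y} ->
  {in S &, forall x y, x * y^-1 \in K -> x = y} ->
  exists T : {set gT},
    [/\ S \subset T, T \subset G,
        {in T &, forall x y, x^-1 * y \in K -> x = y},
        {in T &, forall x y, x * y^-1 \in K -> x = y} &
        (T * K)%g = G /\ (K * T)%g = G].
Proof.
move=> KG SG SL SR.
pose P (T : {set gT}) := [&& T \subset G,
  [forall x in T, forall y in T, (x^-1 * y \in K) ==> (x == y)] &
  [forall x in T, forall y in T, (x * y^-1 \in K) ==> (x == y)]].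
have PP (T : {set gT}) : reflect [/\ T \subset G,
    {in T &, forall x y, x^-1 * y \in K -> x = y} &
    {in T &, forall x y, x * y^-1 \in K -> x = y}] (P T).
  apply: (iffP and3P) => -[TG TL TR]; split=> //.
  - by move=> x y xT yT h; have /forall_inP/(_ x xT)/forall_inP/(_ y yT)/implyP/(_ h)/eqP := TL.
  - by move=> x y xT yT h; have /forall_inP/(_ x xT)/forall_inP/(_ y yT)/implyP/(_ h)/eqP := TR.
  - by apply/forall_inP => x xT; apply/forall_inP => y yT; apply/implyP => h; apply/eqP/TL.
  - by apply/forall_inP => x xT; apply/forall_inP => y yT; apply/implyP => h; apply/eqP/TR.
have /(maxset_exists (P := P))[T maxT ST] : P S by apply/PP.
have /maxsetP[/PP[TG TL TR] Tmax] := maxT.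
have TKG : (T * K)%g = G.
  apply/eqP; rewrite eqEsubset mul_subG//=; apply/subsetP => g gG.
  apply/negPn/negP => gTK.
  pose D := (K :* g * K)%g; pose TD := T :&: D.
  have DK : (D * K = D)%g by rewrite /D -mulgA mulGid.
  have KD : (K * D = D)%g by rewrite /D !mulgA mulGid.
  have TDL : #|(TD * K)%g| = (#|TD| * #|K|)%N.
    by apply: card_mulg_left_partial => x y /setIP[xT _] /setIP[yT _]; apply: TL.
  have TDR : #|(K * TD)%g| = (#|TD| * #|K|)%N.
    by apply: card_mulg_right_partial => x y /setIP[xT _] /setIP[yT _]; apply: TR.
  have gD : g \in D by rewrite -[g]mulg1 mem_mulg// rcoset_refl.
  (* [TD * K] lies in [D] and misses [g]; [K * TD] has the same size, so it cannot fill [D]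
     either. *)
  have ltD : (#|(K * TD)%g| < #|D|)%N.
    rewrite TDR -TDL; apply: proper_card; apply/properP; split.
      by apply: subset_trans (mulSg _ (subsetIr _ _)) _; rewrite DK.
    exists g => //; apply: contra gTK; apply/subsetP; rewrite mulSg//.
    exact: subsetIl.
  have /subsetPn[g' g'D g'TD] : ~~ (D \subset (K * TD)%g).
    by apply: contraL ltD => /subset_leq_card; rewrite -leqNgt.
  have /mulsgP[x k2 /rcosetP[k1 k1K ->{x}] k2K g'E] := g'D.
  (* As [g' = k1 * g * k2], this [t] lies both in the left coset of [g] and in the right coset of
     [g'], neither of which meets [T]. *)
  pose t := g * k2.
  have tD : t \in D by rewrite mem_mulg// rcoset_refl.
  have tTK : t \notin (T * K)%g.
    apply: contra gTK => /mulsgP[u k uT kK tE].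
    rewrite -[g](mulgK k2) -/t tE -mulgA mem_mulg//.
    by rewrite groupM ?groupV.
  have tKT : t \notin (K * T)%g.
    apply: contra g'TD => /mulsgP[k u kK uT tE].
    rewrite g'E -mulgA -/t tE mulgA mem_mulg ?groupM// inE uT /=.
    by rewrite -KD -[u](mulKg k) -tE mem_mulg// groupV.
  have PtT : P (t |: T).
    apply/PP; split.
    - rewrite subUset TG andbT sub1set groupM//.
      exact: (subsetP KG).
    - move=> x y /setU1P[->|xT] /setU1P[->|yT]//; last exact: TL.
      + move=> h; case/negP: tTK; rewrite -[t](mulKVg y) mem_mulg//.
        by rewrite -groupV invMg invgK.
      + by move=> h; case/negP: tTK; rewrite -[t](mulKVg x) mem_mulg.
    - move=> x y /setU1P[->|xT] /setU1P[->|yT]//; last exact: TR.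
      + by move=> h; case/negP: tKT; rewrite -[t](mulgKV y) mem_mulg.
      + move=> h; case/negP: tKT; rewrite -[t](mulgKV x) mem_mulg//.
        by rewrite -groupV invMg invgK.
  have TtT : t |: T = T by apply: Tmax => //; apply: subsetUr.
  case/negP: tTK; by rewrite -[t]mulg1 mem_mulg// -TtT setU11.
(* The right cosets are covered too, since [K * T] has as many elements as [T * K], which is [G]. *)
exists T; split=> //; split=> //; apply/eqP; rewrite eqEcard mul_subG//=.
by rewrite card_mulg_right_partial// -card_mulg_left_partial// TKG.
Qed.

(* Imported only now, since it shadows lemmas of [finset] used above. *)
From mathcomp Require Import all_classical.
From Stdlib Require Import Relation_Operators.

Local Open Scope classical_set_scope.
Local Open Scope group_scope.

(** * Subgroups and cosets in an arbitrary group *)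

Lemma subgroup1 {G : groupType} {H : set G} : is_subgroup H -> H 1.
Proof. by case; rewrite inE. Qed.

Lemma subgroupM {G : groupType} {H : set G} (hH : is_subgroup H) {x y : G} :
  H x -> H y -> H (x * y).
Proof. by move: (@group_closedM _ _ hH x y); rewrite !inE. Qed.

Lemma subgroupV {G : groupType} {H : set G} (hH : is_subgroup H) {x : G} :
  H x -> H x^-1.
Proof. by move: (@group_closedV _ _ hH x); rewrite !inE. Qed.

Lemma subgroupVE {G : groupType} {H : set G} (hH : is_subgroup H) (x : G) :
  H x^-1 <-> H x.
Proof. by split=> [/(subgroupV hH)|/(subgroupV hH)//]; rewrite invgK. Qed.

Lemma subgroupMl {G : groupType} {H : set G} (hH : is_subgroup H) {x : G} (y : G) :
  H x -> H (x * y) <-> H y.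
Proof.
move=> Hx; split=> [|/(subgroupM hH Hx)//].
by move/(subgroupM hH (subgroupV hH Hx)); rewrite mulKg.
Qed.

Lemma subgroupMr {G : groupType} {H : set G} (hH : is_subgroup H) (x : G) {y : G} :
  H y -> H (x * y) <-> H x.
Proof.
move=> Hy; split=> [Hxy|/(subgroupM hH)/(_ Hy)//].
by have := subgroupM hH Hxy (subgroupV hH Hy); rewrite mulgK.
Qed.

Lemma left_cosetE (G : groupType) (H : set G) (g t : G) :
  left_coset H g t <-> H (g^-1 * t).
Proof.
by split=> [[h Hh <-]|Ht]; [rewrite mulKg | exists (g^-1 * t); rewrite ?mulKVg].
Qed.

Lemma right_cosetE (G : groupType) (H : set G) (g t : G) :
  right_coset H g t <-> H (t * g^-1).
Proof.
by split=> [[h Hh <-]|Ht]; [rewrite mulgK | exists (t * g^-1); rewrite ?mulgKV].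
Qed.

Lemma left_coset_eq {G : groupType} {H : set G} (hH : is_subgroup H) (g h : G) :
  left_coset H g = left_coset H h <-> H (g^-1 * h).
Proof.
split=> [E|Hgh].
  apply/left_cosetE; rewrite E; apply/left_cosetE; rewrite mulVg.
  exact: subgroup1.
apply/seteqP; split=> t /left_cosetE Ht; apply/left_cosetE.
  by apply/(subgroupMl hH _ Hgh); rewrite -mulgA mulKVg.
by have := subgroupM hH Hgh Ht; rewrite -mulgA mulKVg.
Qed.

(** * Passage to a finite permutation group *)

Lemma coset_space {G : groupType} {H : set G} :
  is_subgroup H -> finite_index H ->
  exists (X : finType) (p : G -> X),
    [/\ #|X| = subgroup_index H, forall x, exists g, p g = x &
        forall g h, p g = p h <-> H (g^-1 * h)].
Proof.
move=> hH hfin; pose X := fset_set (range (left_coset H)).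
have pX g : left_coset H g \in X by rewrite in_fset_set// inE; exists g.
exists X, (fun g => [` pX g]%fset); split.
- by rewrite -cardfE.
- move=> [x xX]; have := xX; rewrite in_fset_set// inE => -[g _ gx].
  by exists g; apply: val_inj.
- move=> g h; rewrite -(left_coset_eq hH); split=> [[]//|E].
  exact: val_inj.
Qed.

(** [G] permutes the left cosets of [H] by translation, and the coset of 1 has stabiliser [H]. This
    brings coset questions into a finite group. *)
Lemma coset_action {G : groupType} {H : set G} :
  is_subgroup H -> finite_index H ->
  exists (X : finType) (x0 : X) (f : G -> {perm X}),
    {morph f : a b / a * b} /\ forall g, f g x0 = x0 <-> H g.
Proof.
move=> hH hfin; have [X [p [_ psurj pE]]] := coset_space hH hfin.
have [r rK] := boolp.choice psurj.
(* The inverse makes [f] a morphism, since a product of permutations applies its left factor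
   first. *)
pose act g x := p (g^-1 * r x).
have actE g h : act g (p h) = p (g^-1 * h).
  apply/pE; rewrite invMg invgK -mulgA mulKVg; apply/pE.
  by rewrite rK.
have act_inj g : injective (act g).
  by move=> x y /pE; rewrite invMg invgK -mulgA mulKVg => /pE; rewrite !rK.
exists X, (p 1), (fun g => perm (act_inj g)); split=> [a b|g].
  apply/permP => x; rewrite permM !permE -[x]rK !actE.
  by rewrite invMg mulgA.
by rewrite permE actE pE !mulg1 invgK.
Qed.

(** Since [f g] lies in the point stabiliser [K] exactly when [g] lies in [H], cosets of [H]
    correspond to cosets of [K] in the finite image [F] of [G]. The image of [A] is extended there
    and the result is lifted back. *)
Lemma partial_transversal_extends {G : groupType} {H A : set G} :
  is_subgroup H -> finite_index H ->
  {in A &, forall x y, H (x^-1 * y) -> x = y} ->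
  {in A &, forall x y, H (x * y^-1) -> x = y} ->
  exists T : set G, left_right_transversal H T /\ A `<=` T.
Proof.
move=> hH hfin AL AR; have [X [x0 [f [fM fH]]]] := coset_action hH hfin.
have f1 : f 1 = 1 by apply: (mulgI (f 1)); rewrite -fM !mulg1.
have fV a : f a^-1 = (f a)^-1 by apply: (mulgI (f a)); rewrite -fM !mulgV.
pose F := [set s : {perm X} | `[< exists g, f g = s >]]%SET.
have FP s : reflect (exists g, f g = s) (s \in F) by rewrite inE; apply: asboolP.
have fF g : f g \in F by apply/FP; exists g.
have gF : group_set F.
  apply/group_setP; split; first by apply/FP; exists 1.
  by move=> _ _ /FP[a <-] /FP[b <-]; apply/FP; exists (a * b).
pose K := [set s in F | s x0 == x0]%SET.
have KH g : f g \in K <-> H g.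
  by split=> [/setIdP[_ /eqP/fH]//|/fH/eqP gx0]; apply/setIdP.
have gK : group_set K.
  apply/group_setP; split; first by rewrite -f1; apply/KH/subgroup1.
  move=> s t /setIdP[/FP[a <-] /eqP sK] /setIdP[/FP[b <-] tK].
  by apply/setIdP; rewrite permM sK -fM fF.
pose S := [set s : {perm X} | `[< exists2 g, A g & f g = s >]]%SET.
have SP s : reflect (exists2 g, A g & f g = s) (s \in S).
  by rewrite inE; apply: asboolP.
have [||||Tb [STb TbF TbL TbR [TbK KTb]]] :=
    @partial_transversal_extends_fin _ (Group gF) (Group gK) S.
- by apply/fintype.subsetP => s; rewrite inE => /andP[].
- by apply/fintype.subsetP => s /SP[g _ <-].
- move=> _ _ /SP[a Aa <-] /SP[b Ab <-]; rewrite -fV -fM => /KH/AL->//;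
    by rewrite inE.
- move=> _ _ /SP[a Aa <-] /SP[b Ab <-]; rewrite -fV -fM => /KH/AR->//;
    by rewrite inE.
have [r rK] : {r : {perm X} -> G & forall s, s \in F -> f (r s) = s}.
  apply: (@boolp.choice _ _ (fun s g => s \in F -> f g = s)) => s.
  by have [/FP[g]|] := boolP (s \in F); [exists g | exists 1].
(* Over the image of [A] the lifts are the elements of [A] themselves, elsewhere one chosen preimage
   each; so [T] contains [A] and [f] is injective on it. *)
pose T := [set g | A g \/ exists2 s, s \in Tb :\: S & g = r s].
have fT g : T g -> f g \in Tb.
  case=> [Ag|[s /finset.setDP[sT sS] ->]]; first by apply/(fintype.subsetP STb)/SP; exists g.
  by rewrite rK// (fintype.subsetP TbF).
have Tf s : s \in Tb -> exists2 g, T g & f g = s.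
  move=> sT; have [/SP[g Ag fg]|sS] := boolP (s \in S).
    by exists g => //; left.
  exists (r s); last by rewrite rK// (fintype.subsetP TbF).
  by right; exists s => //; rewrite inE sS.
have fI x y : T x -> T y -> f x = f y -> x = y.
  have rS s : s \in Tb :\: S -> f (r s) \notin S.
    by move=> /finset.setDP[sT sS]; rewrite rK// (fintype.subsetP TbF).
  have AS a : A a -> f a \in S by move=> Aa; apply/SP; exists a.
  move=> [Ax|[s sT ->]] [Ay|[t tT ->]] fxy.
  - apply: AL; rewrite ?inE//; apply/KH.
    by rewrite fM fV fxy mulVg -f1; apply/KH/subgroup1.
  - by have := rS _ tT; rewrite -fxy AS.
  - by have := rS _ sT; rewrite fxy AS.
  - move: fxy; rewrite !rK; first by move->.
    + by apply: (fintype.subsetP TbF); case/finset.setDP: tT.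
    + by apply: (fintype.subsetP TbF); case/finset.setDP: sT.
exists T; split; last by move=> g Ag; left.
split=> g.
- have /mulsgP[s k sT kK fg] : f g \in (Tb * K)%g by rewrite TbK.
  have [t Tt ft] := Tf s sT; exists t; split.
    split=> //; apply/left_cosetE/KH; rewrite fM fV fg ft invMg mulgKV.
    exact: (groupVr (G := Group gK)).
  move=> u [Tu /left_cosetE Hu]; apply: fI => //.
  apply: TbL; rewrite ?fT// -fV -fM; apply/KH.
  have -> : t^-1 * u = (g^-1 * t)^-1 * (g^-1 * u).
    by rewrite invMg invgK -mulgA mulKVg.
  apply: subgroupM => //; apply: subgroupV => //; apply/KH.
  rewrite fM fV fg ft invMg mulgKV.
  exact: (groupVr (G := Group gK)).
- have /mulsgP[k s kK sT fg] : f g \in (K * Tb)%g by rewrite KTb.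
  have [t Tt ft] := Tf s sT.
  have Htg : H (t * g^-1).
    apply/KH; rewrite fM fV fg ft invMg mulKVg.
    exact: (groupVr (G := Group gK)).
  exists t; split; first by split=> //; apply/right_cosetE.
  move=> u [Tu /right_cosetE Hu]; apply: fI => //.
  apply: TbR; rewrite ?fT// -fV -fM; apply/KH.
  have -> : t * u^-1 = (t * g^-1) * (u * g^-1)^-1.
    by rewrite invMg invgK mulgA mulgKV.
  by apply: subgroupM => //; apply: subgroupV.
Qed.

(** * Nielsen moves and separated entries *)

Definition separated {G : groupType} (H : set G) (x y : G) : Prop :=
  ~ H (x^-1 * y) /\ ~ H (x * y^-1).

Lemma separated_sym {G : groupType} {H : set G} (hH : is_subgroup H) {x y : G} :
  separated H x y -> separated H y x.
Proof.
by case=> l r; split; move/(subgroupV hH); rewrite invMg invgK.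
Qed.

Lemma separated_in_out {G : groupType} {H : set G} (hH : is_subgroup H) {x y : G} :
  H x -> ~ H y -> separated H x y.
Proof.
move=> Hx Hy; split; first by move/(subgroupMl hH _ (subgroupV hH Hx)).
by move/(subgroupMl hH _ Hx)/(subgroupVE hH).
Qed.

Lemma replace_entryE {G : groupType} {n : nat} (S : {ffun 'I_n -> G}) i x k :
  replace_entry S i x k = if k == i then x else S k.
Proof. by rewrite ffunE. Qed.

(** Each old entry is a product of new entries and their inverses. Applied to every subgroup [K]
    containing the new tuple, this shows that moves preserve generation. *)
Lemma nielsen_move_range (G : groupType) (n : nat) (S S' : {ffun 'I_n -> G})
    (K : set G) :
  is_subgroup K -> nielsen_move S S' -> range S' `<=` K -> range S `<=` K.
Proof.
move=> hK SS' S'K; have {}S'K l : K (S' l) by apply: S'K; exists l.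
suff SK l : K (S l) by move=> _ [l _ <-].
have mult i j x : j != i -> S' = replace_entry S i x ->
    K (S j) /\ K x /\ (K (S i) -> K (S l)).
  move=> ji S'E; move: (S'K j) (S'K i) (S'K l).
  by rewrite S'E !replace_entryE eqxx (negbTE ji); case: eqP => [->|].
move: SS' S'K mult => [[i j ji|i j ji|i j ji|i j ji]|[i|i j ij]] S'K mult.
- have [Kj [Kx]] := mult _ _ _ ji erefl; apply.
  exact/(subgroupMl hK _ Kj).
- have [Kj [Kx]] := mult _ _ _ ji erefl; apply.
  exact/(subgroupMl hK _ (subgroupV hK Kj)).
- have [Kj [Kx]] := mult _ _ _ ji erefl; apply.
  exact/(subgroupMr hK _ Kj).
- have [Kj [Kx]] := mult _ _ _ ji erefl; apply.
  exact/(subgroupMr hK _ (subgroupV hK Kj)).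
- have := S'K l; rewrite replace_entryE; case: eqP => [->|//].
  by move/(subgroupVE hK).
- by have := S'K (tperm i j l); rewrite ffunE tpermK.
Qed.

Lemma nielsen_equivalent_generating (G : groupType) (n : nat)
    (S S' : {ffun 'I_n -> G}) :
  nielsen_equivalent S S' -> generating_tuple S -> generating_tuple S'.
Proof.
elim=> {S S'} [S S' SS' gS|//|S S1 S2 _ IH1 _ IH2 /IH1/IH2//].
apply/seteqP; split=> // x _ K [hK S'K].
have : Defs.generated (range S) x by rewrite gS.
by apply; split=> //; apply: nielsen_move_range SS' S'K.
Qed.

Lemma generating_subset_full {G : groupType} {n : nat} {S : {ffun 'I_n -> G}}
    {K : set G} :
  generating_tuple S -> is_subgroup K -> (forall i, K (S i)) -> forall g, K g.
Proof.
move=> gS hK SK g; have : Defs.generated (range S) g by rewrite gS.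
by apply; split=> // _ [i _ <-].
Qed.

(** Induction on the number of entries outside [H], which drops whenever a quotient move is made on
    a pair sharing a coset. *)
Lemma separated_outside (G : groupType) (n : nat) (H : set G)
    (S : {ffun 'I_n -> G}) :
  exists S', nielsen_equivalent S S' /\
    forall i j, i != j -> ~ H (S' i) -> ~ H (S' j) -> separated H (S' i) (S' j).
Proof.
pose out (S : {ffun 'I_n -> G}) := [pred i | `[< ~ H (S i) >]].
have lt_out (S1 : {ffun 'I_n -> G}) i x :
    ~ H (S1 i) -> H x -> (#|out (replace_entry S1 i x)| < #|out S1|)%N.
  move=> HSi Hx; apply: proper_card; apply/fintype.properP; split.
    apply/fintype.subsetP => l; rewrite !inE replace_entryE; case: eqP => [->|//].
    by move=> /(_ Hx).
  exists i; first by rewrite inE.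
  by rewrite inE replace_entryE eqxx; apply/asboolPn; apply.
have [m] := ubnP #|out S|; elim: m S => // m IH S /ltnSE leSm.
have step i x : ~ H (S i) -> H x -> nielsen_move S (replace_entry S i x) ->
    exists S', nielsen_equivalent S S' /\
    forall i j, i != j -> ~ H (S' i) -> ~ H (S' j) -> separated H (S' i) (S' j).
  move=> HSi Hx SS1.
  have [S' [S1S' S'P]] := IH _ (leq_trans (lt_out S i x HSi Hx) leSm).
  by exists S'; split=> //; apply: rt_trans S1S'; apply: rt_step.
(* If no suitable tuple existed, [S] itself would be one: a bad pair in [S] would allow [step],
   which yields such a tuple. *)
have [//|noS'] := pselect (exists S', nielsen_equivalent S S' /\
    forall i j, i != j -> ~ H (S' i) -> ~ H (S' j) -> separated H (S' i) (S' j)).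
exists S; split; first exact: rt_refl.
move=> i j ij Hi Hj; split=> Hij; apply: noS'.
- by apply: (step j _ Hj Hij); left; apply: Nielsen_mulVl.
- by apply: (step i _ Hi Hij); left; apply: Nielsen_mulrV; rewrite eq_sym.
Qed.

(** * Index bounds and triples with two entries in the subgroup *)

Lemma subgroup_index_le {G : groupType} {H : set G} (s : seq G) :
  is_subgroup H -> finite_index H ->
  (forall g, exists2 c, c \in s & H (c^-1 * g)) ->
  (subgroup_index H <= size s)%N.
Proof.
move=> hH hfin Hs; have [X [p [<- psurj pE]]] := coset_space hH hfin.
rewrite -(size_map p) cardE; apply: uniq_leq_size; first exact: enum_uniq.
move=> x _; have [g <-] := psurj x; have [c cs /pE<-] := Hs g.
exact: map_f.
Qed.

(* The union of [H] and [cH] is stable under left multiplication by every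
   generator and its inverse. *)
Lemma subgroup_index_le2 {G : groupType} {H : set G} {n : nat} {S : {ffun 'I_n -> G}} (c : G) :
  is_subgroup H -> finite_index H -> generating_tuple S -> H (c * c) ->
  (forall i, S i = c \/ H (S i) /\ H (c^-1 * S i * c)) ->
  (subgroup_index H <= 2)%N.
Proof.
move=> hH hfin gS Hcc Si.
pose A x := H x \/ H (c^-1 * x).
pose U := [set g | (forall x, A x -> A (g * x)) /\ (forall x, A x -> A (g^-1 * x))].
have hU : is_subgroup U.
  split; first by rewrite inE; split=> x; rewrite ?invg1 mul1g.
  move=> u v /[!inE] -[u1 u2] [v1 v2]; split=> x Ax.
    by rewrite -mulgA; apply/u1/v2.
  by rewrite invMg invgK -mulgA; apply/v1/u2.
(* As [a * c = c * (c^-1 * a * c)], such an [a] maps [cH] into itself. *)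
have HA a : H a -> H (c^-1 * a * c) -> forall x, A x -> A (a * x).
  move=> Ha Hca x [Hx|Hcx]; first by left; apply: subgroupM.
  right; have := subgroupM hH Hca Hcx.
  by rewrite -!mulgA mulKVg.
have SU i : U (S i).
  case: (Si i) => [->|[Ha Hca]]; last first.
    split; first exact: HA.
    apply: HA; first exact: subgroupV.
    by have := subgroupV hH Hca; rewrite !invMg invgK mulgA.
  (* Multiplication by [c] swaps [H] and [cH], because [c * c] is in [H]. *)
  split=> x [Hx|Hcx].
  - by right; rewrite mulKg.
  - by left; have := subgroupM hH Hcc Hcx; rewrite -mulgA mulKVg.
  - right; have := subgroupM hH (subgroupV hH Hcc) Hx.
    by rewrite invMg mulgA.
  - by left.
have Ag g : A g.
  have [Ug _] := generating_subset_full gS hU SU g.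
  by rewrite -[g]mulg1; apply: Ug; left; apply: subgroup1.
apply: (@subgroup_index_le _ _ [:: 1; c]) => // g.
case: (Ag g) => [Hg|Hcg]; first by exists 1; rewrite ?invg1 ?mul1g// inE eqxx.
by exists c => //; rewrite !inE eqxx orbT.
Qed.

(** With [a], [b], [c] the entries at [i], [j], [k], two moves turn [b] into [c b c]. This is
    outside [H], hence separated from [a]; its quotients with [c] are [b c] and [(c b)^-1] up to
    inversion, both outside [H]. *)
Lemma separated_conj {G : groupType} {n : nat} {H : set G}
    {S : {ffun 'I_n -> G}} {i j k : 'I_n} :
  is_subgroup H -> i != j -> k != i -> k != j ->
  (forall l, l \in [:: i; j; k]) ->
  H (S i) -> H (S j) -> ~ H (S k) -> ~ H (S k * S j * S k) ->
  exists S', nielsen_equivalent S S' /\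
    forall a b, a != b -> separated H (S' a) (S' b).
Proof.
move=> hH ij ki kj all3 Hi Hj Hk Hkjk.
pose S1 := replace_entry S j (S k * S j).
pose S2 := replace_entry S1 j (S1 j * S1 k).
have S1E l : S1 l = if l == j then S k * S j else S l by rewrite replace_entryE.
have S2E l : S2 l = if l == j then S k * S j * S k else S l.
  by rewrite replace_entryE !S1E eqxx (negbTE kj); case: eqP.
exists S2; split.
  apply: (@rt_trans _ _ _ S1); apply: rt_step; left.
    exact: Nielsen_mull.
  exact: Nielsen_mulr.
have sij : separated H (S2 i) (S2 j).
  by rewrite !S2E eqxx (negbTE ij); apply: separated_in_out.
have sik : separated H (S2 i) (S2 k).
  by rewrite !S2E (negbTE ij) (negbTE kj); apply: separated_in_out.
have skj : separated H (S2 k) (S2 j).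
  rewrite !S2E eqxx (negbTE kj); split; first by rewrite -mulgA mulKg => /(subgroupMl hH _ Hj).
  rewrite !invMg mulKVg => /(subgroupMl hH _ (subgroupV hH Hj)).
  by move/(subgroupVE hH).
move=> a b; move: (all3 a) (all3 b); rewrite !inE.
by case/or3P=> /eqP-> /or3P[]/eqP->; rewrite ?eqxx// => _ //;
  apply: separated_sym.
Qed.

Lemma separated_two_inside (G : groupType) (n : nat) (H : set G)
    (S : {ffun 'I_n -> G}) (i j : 'I_n) :
  is_subgroup H -> finite_index H -> generating_tuple S ->
  (n <= 3)%N -> (n <= subgroup_index H)%N -> i != j ->
  H (S i) -> H (S j) ->
  exists S', nielsen_equivalent S S' /\
    forall a b, a != b -> separated H (S' a) (S' b).
Proof.
move=> hH hfin gS n3 nH ij Hi Hj.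
have card_lt (s : seq 'I_n) : uniq s -> (size s <= n)%N.
  by move=> us; have := max_card (mem s); rewrite card_ord (card_uniqP us).
(* All entries in [H] would give index at most 1, while the distinct [i] and [j] force [n] to be at
   least 2. *)
have [k Hk] : exists k, ~ H (S k).
  apply: contrapT => noK.
  have HS l : H (S l) by apply: contrapT => Hl; apply: noK; exists l.
  have /(leq_trans nH) : (subgroup_index H <= 1)%N.
    apply: (@subgroup_index_le _ _ [:: 1]) => // g; exists 1; rewrite ?inE//.
    exact: (generating_subset_full gS hH HS).
  have := card_lt [:: i; j]; rewrite /= inE ij => /(_ isT) /leq_trans h /h.
  by [].
have ki : k != i by apply: contra_notN Hk => /eqP->.
have kj : k != j by apply: contra_notN Hk => /eqP->.
have u3 : uniq [:: i; j; k] by rewrite /= !inE negb_or ij eq_sym ki eq_sym kj.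
have all3 l : l \in [:: i; j; k].
  apply: contraT => lijk; have := card_lt (l :: [:: i; j; k]).
  by rewrite cons_uniq lijk u3 => /(_ isT)/leq_trans/(_ n3).
have [Hkjk|] := pselect (H (S k * S j * S k)); 
  last exact: (separated_conj hH ij ki kj all3 Hi Hj Hk).
have [Hkik|] := pselect (H (S k * S i * S k)); last first.
  apply: (separated_conj hH _ kj ki _ Hj Hi Hk); first by rewrite eq_sym.
  by move=> l; have := all3 l; rewrite !inE orbCA.
(* The third candidate [a^-1 b] must first be made an entry, by one more move. *)
pose S1 := replace_entry S j ((S i)^-1 * S j).
have S1E l : S1 l = if l == j then (S i)^-1 * S j else S l by rewrite replace_entryE.
have SS1 : nielsen_equivalent S S1 by apply: rt_step; left; apply: Nielsen_mulVl.
have [Hkyk|Hkyk] := pselect (H (S1 k * S1 j * S1 k)); last first.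
  have [|||S' [S1S' S'P]] := separated_conj (S := S1) hH ij ki kj all3 _ _ _ Hkyk.
  - by rewrite S1E (negbTE ij).
  - by rewrite S1E eqxx; apply: subgroupM => //; apply: subgroupV.
  - by rewrite S1E (negbTE kj).
  - by exists S'; split=> //; apply: rt_trans S1S'.
move: Hkyk; rewrite !S1E eqxx (negbTE kj); set c := S k in Hkjk Hkik *.
set y := (S i)^-1 * S j => Hcyc.
(* This is [(c a c)^-1 (c b c)], with [a] and [b] the entries of [S] at [i] and [j]. *)
have HcVyc : H (c^-1 * y * c).
  have := subgroupM hH (subgroupV hH Hkik) Hkjk.
  by rewrite /y !invMg -!mulgA mulKg.
have Hcc : H (c * c).
  have := subgroupM hH Hcyc (subgroupV hH HcVyc); move: y {Hcyc HcVyc} => y.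
  by rewrite !invMg invgK !mulgA !mulgK.
have conj x : H (c * x * c) -> H (c^-1 * x * c).
  move=> Hx; have := subgroupM hH (subgroupV hH Hcc) Hx.
  by rewrite invMg -!mulgA mulKg.
have /(leq_trans nH) : (subgroup_index H <= 2)%N.
  apply: (@subgroup_index_le2 _ _ _ S c) => // l.
  have := all3 l; rewrite !inE => /or3P[]/eqP->; [right|right|by left];
    by split=> //; apply: conj.
(* The three distinct indices give [n >= 3]. *)
by move=> n2; have := leq_trans (card_lt _ u3) n2.
Qed.

Theorem theorem3p11 (G : groupType) (n : nat) (S : {ffun 'I_n -> G}) (H : set G)
    (hS : generating_tuple S) (hn : (n <= 3)%N)
    (hH : is_subgroup H) (hfin : finite_index H)
    (hindex : (n <= subgroup_index H)%N) :
  exists (S' : {ffun 'I_n -> G}) (T : set G),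
    [/\ generating_tuple S', nielsen_equivalent S S',
        left_right_transversal H T & range S' `<=` T].
Proof.
suff [S' [SS' S'sep]] : exists S', nielsen_equivalent S S' /\
    forall a b, a != b -> separated H (S' a) (S' b).
  have [||T [TLR S'T]] := @partial_transversal_extends _ H (range S') hH hfin.
  - move=> x y /[!inE] -[a _ <-] [b _ <-] Hab; apply: contrapT => ab.
    by have [|+ _] := S'sep a b; [apply: contra_notN ab => /eqP->|].
  - move=> x y /[!inE] -[a _ <-] [b _ <-] Hab; apply: contrapT => ab.
    by have [|_] := S'sep a b; [apply: contra_notN ab => /eqP->|].
  exists S', T; split=> //; exact: nielsen_equivalent_generating SS' hS.
have [S1 [SS1 S1out]] := separated_outside _ _ H S.
have gS1 := nielsen_equivalent_generating _ _ _ _ SS1 hS.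
(* If at most one entry lies in [H], then [S1] is already separated; otherwise two entries in [H]
   need further moves. *)
have [[i [j [ij Hi Hj]]]|inside1] :=
    pselect (exists i j, [/\ i != j, H (S1 i) & H (S1 j)]).
  have [S' [S1S' S'P]] :=
    separated_two_inside _ _ _ _ _ _ hH hfin gS1 hn hindex ij Hi Hj.
  by exists S'; split=> //; apply: rt_trans S1S'.
exists S1; split=> // i j ij.
have [Hi|Hi] := pselect (H (S1 i)); have [Hj|Hj] := pselect (H (S1 j)).
- by case: inside1; exists i, j.
- exact: separated_in_out.
- exact/separated_sym/separated_in_out.
- exact: S1out.
Qed.
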